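(* There exist absolute constants $c,c'>0$ such that the following holds. Let $(f(n))_{n\in\mathbb{N}}$ be an arbitrary sequence of integers with $f(n)\to\infty$ as $n\to\infty$ and $f(n)<\sqrt{n/2}$. Then for all sufficiently large $n$ there exist an integer $N=N(n)$ with $\frac n2\le N\le n$ and a polytope $P_N\subset\mathbb{R}^N$, with vertex set $V_N$ and facet set $\mathcal{F}_N$, such that $$|V_N|\sim 2^{c\frac{n}{f(n)}}\quad\text{and}\quad |\mathcal{F}_N|\sim n\,\frac{2^{c'f(n)}}{f(n)}.$$ In particular, $$\log|V_N|\cdot\log|\mathcal{F}_N|\sim N\left(1+\frac{\log N}{f(n)}\right).$$
   Context: A polytope in $\mathbb{R}^N$ is the convex hull of finitely many points with non-empty interior. Vertices are its $0$-dimensional faces and facets are its $(N-1)$-dimensional faces. For positive quantities $A,B$, $A\sim B$ means $C_1B\le A\le C_2B$ for some absolute constants $C_1,C_2>0$ (independent of $n$ and $f$). Logarithms are natural. *)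

(* Defs.v *)
From HB Require Import structures.
From mathcomp Require Import all_boot all_order all_algebra.
From mathcomp Require Import all_classical all_reals all_analysis.

Set Implicit Arguments.
Unset Strict Implicit.
Unset Printing Implicit Defensive.

Import Order.TTheory GRing.Theory Num.Theory.
Import numFieldNormedType.Exports.

Local Open Scope classical_set_scope.
Local Open Scope ring_scope.

Section Polytopes.
Variables (R : realType) (N : nat).
Local Notation V := 'rV[R]_N.
Implicit Types (S P F : set V).

Definition aff_hull S : set V :=
  [set x | exists (k : nat) (p : 'I_k -> V) (w : 'I_k -> R),
     [/\ forall i, S (p i), \sum_i w i = 1 & x = \sum_i w i *: p i]].

Definition conv_hull S : set V :=
  [set x | exists (k : nat) (p : 'I_k -> V) (w : 'I_k -> R),
     [/\ forall i, S (p i), forall i, 0 <= w i, \sum_i w i = 1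
       & x = \sum_i w i *: p i]].

(* [interior P] is the interior for the product topology of 'rV[R]_N, which is the
   Euclidean one. *)
Definition is_polytope P : Prop :=
  (exists2 S : set V, finite_set S & P = conv_hull S) /\ interior P !=set0.

(* Intersections with supporting hyperplanes.  The choice u = 0 also makes P
   and set0 faces; set0 has no dimension in the sense of [has_dim]. *)
Definition is_face P F : Prop :=
  exists (u : V) (b : R),
    (forall x, P x -> \sum_j u 0 j * x 0 j <= b) /\
    F = P `&` [set x | \sum_j u 0 j * x 0 j = b].

(* The affine hull of S is a translate of a k-dimensional linear subspace. *)
Definition has_dim S (k : nat) : Prop :=
  exists (x : V) (U : {vspace V}),
    \dim U = k /\ aff_hull S = [set x + u | u in [set` U]].

Definition faces P (k : nat) : set (set V) :=
  [set F | is_face P F /\ has_dim F k].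

(* A vertex v is represented by the face [set v]. *)
Definition vertices P : set (set V) := faces P 0.

(* Meaningful for N > 0 only. *)
Definition facets P : set (set V) := faces P N.-1.

End Polytopes.

(* A ~ B with constants C1 and C2. *)
Definition comparable_with (R : realType) (C1 C2 A B : R) : Prop :=
  C1 * B <= A /\ A <= C2 * B.

(* Main.v *)
Require Import Defs.
From HB Require Import structures.
From mathcomp Require Import all_boot all_order all_algebra.
From mathcomp Require Import all_classical all_reals all_analysis.
From mathcomp Require Import zify ring lra.

(** The polytopes are chain polytopes of finite posets.  For a strict order on
    a finite set T, the chain polytope lives in the space of functions on T and
    consists of the nonnegative functions whose sum over every maximal chain is
    at most 1.  Its vertices are the indicators of the antichains, and its
    facets are cut out by the #|T| inequalities x_p >= 0 and by one inequality
    for each maximal chain (Stanley).  A polytope with prescribed dimension,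
    number of vertices and number of facets thus comes from a poset with
    prescribed numbers of elements, antichains and maximal chains.

    These three numbers are easy to control: a disjoint union multiplies the
    numbers of antichains and adds the numbers of maximal chains, while an
    ordinal sum nearly adds the numbers of antichains and multiplies the numbers
    of maximal chains.  Write k for f(n).  The poset is a disjoint union of
    - about n / (2 D^2) copies of a poset with D^2 elements, D a power of 2 near
      k / 8 up to a factor 2, having only 2^O(D) antichains and 2^O(D) maximal
      chains; it is obtained by alternating the two sums, and it supplies the
      dimension n / 2 at the cost of 2^O(n/k) vertices and n 2^O(k) / k facets;
    - an ordinal sum of k + log (n / k) antichains of size 2, which brings the
      number of facets to the order of n 2^k / k with few vertices;
    - as many isolated points as it takes to raise the number of vertices, which
      each point doubles, to the order of 2^(16 n/k).
    The condition 2 k^2 < n leaves room for all of this within n elements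
    ([realizable_target]).

    For the geometry, the decomposition of a point of the chain polytope into
    indicators of antichains peels off the minimal elements of its support
    ([antichain_decomposition]).  Vertices and facets are then read off from
    certificates: a linear functional that exposes each indicator
    ([vertices_conv_hull]), and for each inequality a point at which it alone is
    tight ([facets_halfspaces]). *)

Set Implicit Arguments.
Unset Strict Implicit.
Unset Printing Implicit Defensive.

Import Order.TTheory GRing.Theory Num.Theory.
Import numFieldNormedType.Exports.

(** * Antichains and maximal chains of sums of posets *)

Section Posets.
Variables (T : finType) (lt : rel T).
Implicit Types (p q : T) (C A : {set T}).

Definition strict_order := irreflexive lt /\ transitive lt.

Definition cmp p q := [|| p == q, lt p q | lt q p].

Definition chain C := [forall p in C, forall q in C, cmp p q].

(** An element belongs to a maximal chain exactly when it is comparable to all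
    its elements: one inclusion says chain, the other says maximal.  This pointwise
    form splits along sums of posets without comparing sets. *)
Definition maxchain C := [forall p, (p \in C) == [forall q in C, cmp p q]].

Definition antichain A := [forall p in A, forall q in A, ~~ lt p q].

Definition antichains := [set A | antichain A].
Definition maxchains := [set C | maxchain C].

Lemma cmpC p q : cmp p q = cmp q p.
Proof. by rewrite /cmp eq_sym [lt p q || _]orbC. Qed.

Lemma chainP C : reflect {in C &, forall p q, cmp p q} (chain C).
Proof.
apply: (iffP forall_inP) => [h p q pC qC|h p pC]; first exact: (forall_inP (h p pC)).
by apply/forall_inP => q qC; apply: h.
Qed.

Lemma antichainP A : reflect {in A &, forall p q, ~~ lt p q} (antichain A).
Proof.
apply: (iffP forall_inP) => [h p q pC qC|h p pC]; first exact: (forall_inP (h p pC)).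
by apply/forall_inP => q qC; apply: h.
Qed.

Lemma maxchainP C :
  reflect (forall p, (p \in C) = [forall q in C, cmp p q]) (maxchain C).
Proof. by apply: (iffP forallP) => h p; apply/eqP. Qed.

Lemma maxchain_chain C : maxchain C -> chain C.
Proof.
move=> /maxchainP h; apply/chainP => p q.
by rewrite h => /forall_inP; apply.
Qed.

Lemma chainU1 p C : chain C -> {in C, forall q, cmp p q} -> chain (p |: C).
Proof.
move=> /chainP chC h; apply/chainP => x y.
rewrite !inE => /orP[/eqP->|xC] /orP[/eqP->|yC]; first by rewrite /cmp eqxx.
- exact: h.
- by rewrite cmpC h.
- exact: chC.
Qed.

Lemma chain_sub_maxchain C :
  chain C -> exists2 C', maxchain C' & C \subset C'.
Proof.
move=> /(maxset_exists (P := chain)) [C' /maxsetP[chC' maxC'] sub]; exists C' => //.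
apply/maxchainP => p; apply/idP/forall_inP => [pC' q qC'|h].
  exact: (chainP _ chC').
by rewrite -(maxC' _ (chainU1 chC' h)) ?finset.subsetUr// setU11.
Qed.

Lemma maxchain_antisym C C' : maxchain C -> maxchain C' -> C \subset C' -> C = C'.
Proof.
move=> /maxchainP hC /maxchain_chain/chainP hC' sub; apply/eqP.
rewrite finset.eqEsubset sub; apply/fintype.subsetP => p pC'; rewrite hC.
by apply/forall_inP => q /(fintype.subsetP sub) qC'; apply: hC'.
Qed.

Lemma maxchain_neq0 p C : maxchain C -> C != finset.set0.
Proof.
move=> /maxchainP h; apply/eqP => C0; have := h p.
rewrite C0 finset.in_set0 => /esym/negbT/forall_inPn[q]; by rewrite finset.in_set0.
Qed.

Lemma antichain_meets_chain A C p q : antichain A -> chain C ->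
  p \in A -> p \in C -> q \in A -> q \in C -> p = q.
Proof.
move=> /antichainP hA /chainP hC pA pC qA qC; apply/eqP.
by have := hC _ _ pC qC; rewrite /cmp (negbTE (hA _ _ pA qA)) (negbTE (hA _ _ qA pA)) !orbF.
Qed.

(** Among the elements of D that are equal to p or below it, one with the fewest
    elements of D below it is minimal in D. *)
Lemma exists_minimal (D : {set T}) p : strict_order -> p \in D ->
  exists a, [/\ a \in D, (a == p) || lt a p & {in D, forall b, ~~ lt b a}].
Proof.
move=> [irr tr] pD.
pose below a := #|[set b in D | lt b a]|.
have Pp : (p \in D) && ((p == p) || lt p p) by rewrite pD eqxx.
have [a /andP[aD ap] amin] :=
  @arg_minnP _ p (fun a => (a \in D) && ((a == p) || lt a p)) below Pp.
exists a; split=> // b bD; apply/negP => ba.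
have bp : (b == p) || lt b p.
  by case/orP: ap => [/eqP <-|ap]; rewrite ?ba ?orbT// (tr _ _ _ ba ap) orbT.
have := amin b; rewrite bD bp => /(_ isT); rewrite leqNgt => /negP; apply.
apply: proper_card; apply/properP; split.
  by apply/fintype.subsetP => x; rewrite !inE => /andP[-> /tr]; apply.
by exists b; rewrite !inE ?bD ?ba// irr andbF.
Qed.

End Posets.

Section Sums.
Variables (T1 T2 : finType) (lt1 : rel T1) (lt2 : rel T2).

Definition par_lt (x y : T1 + T2) :=
  match x, y with
  | inl a, inl b => lt1 a b
  | inr a, inr b => lt2 a b
  | _, _ => false
  end.

Definition ser_lt (x y : T1 + T2) :=
  match x, y with
  | inl a, inl b => lt1 a b
  | inr a, inr b => lt2 a b
  | inl _, inr _ => true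
  | inr _, inl _ => false
  end.

Lemma par_strict_order :
  strict_order lt1 -> strict_order lt2 -> strict_order par_lt.
Proof.
move=> [i1 t1] [i2 t2]; split; first by case=> x /=.
by case=> b [] a [] c //=; [apply: t1|apply: t2].
Qed.

Lemma ser_strict_order :
  strict_order lt1 -> strict_order lt2 -> strict_order ser_lt.
Proof.
move=> [i1 t1] [i2 t2]; split; first by case=> x /=.
by case=> b [] a [] c //=; [apply: t1|apply: t2].
Qed.

(** The subsets of a sum type as pairs of subsets, for counting. *)
Definition sumset (X : {set T1} * {set T2}) : {set T1 + T2} :=
  [set s | match s with inl a => a \in X.1 | inr b => b \in X.2 end].

Definition unsumset (S : {set T1 + T2}) : {set T1} * {set T2} :=
  ([set a | inl a \in S], [set b | inr b \in S]).

Lemma sumsetK : cancel sumset unsumset.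
Proof. by case=> A B; congr pair; apply/setP => x; rewrite !inE. Qed.

Lemma unsumsetK : cancel unsumset sumset.
Proof. by move=> S; apply/setP => -[] x; rewrite !inE. Qed.

Lemma card_sumset (Q : pred {set T1 + T2}) (D : {set {set T1} * {set T2}}) :
  (forall X, Q (sumset X) = (X \in D)) -> #|[set S | Q S]| = #|D|.
Proof.
move=> QD; rewrite -(card_imset _ (can_inj sumsetK)); apply: eq_card => S.
rewrite inE -[S in LHS]unsumsetK QD.
apply/idP/imsetP => [h|[X XD ->]]; first by exists (unsumset S); rewrite ?unsumsetK.
by rewrite sumsetK.
Qed.

Lemma forall_in_sumset X (Q : pred (T1 + T2)) :
  [forall q in sumset X, Q q] =
  [forall q in X.1, Q (inl q)] && [forall q in X.2, Q (inr q)].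
Proof.
apply/forall_inP/andP => [h|[/forall_inP h1 /forall_inP h2] [] q]; last 2 first.
- by rewrite inE; apply: h1.
- by rewrite inE; apply: h2.
by split; apply/forall_inP => q qX; apply: h; rewrite inE.
Qed.

Lemma forall_in_false (T : finType) (A : {set T}) : [forall q in A, false] = (A == finset.set0).
Proof.
apply/forall_inP/eqP => [h|-> q]; last by rewrite inE.
by apply/setP => x; rewrite inE; apply/negP => /h.
Qed.

Lemma forall_in_true (T : finType) (A : {set T}) : [forall q in A, true].
Proof. exact/forall_inP. Qed.

Lemma antichain_par X :
  antichain par_lt (sumset X) = antichain lt1 X.1 && antichain lt2 X.2.
Proof.
rewrite /antichain forall_in_sumset; congr andb; apply: eq_forallb_in => p pX;
  by rewrite forall_in_sumset /= forall_in_true ?andbT.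
Qed.

Lemma antichain_ser X : antichain ser_lt (sumset X) ->
  (antichain lt1 X.1 && (X.2 == finset.set0)) || ((X.1 == finset.set0) && antichain lt2 X.2).
Proof.
have [-> /antichainP h|[q qX] /antichainP h] := set_0Vmem X.2.
  rewrite eqxx andbT; apply/orP; left; apply/antichainP => a b aX bX.
  by have := h (inl a) (inl b); rewrite !inE; apply.
suff X0 : X.1 == finset.set0.
  rewrite X0; apply/orP; right; apply/antichainP => a b aX bX.
  by have := h (inr a) (inr b); rewrite !inE; apply.
apply/eqP/setP => p; rewrite inE; apply/negP => pX.
by have := h (inl p) (inr q); rewrite !inE => /(_ pX qX).
Qed.

Lemma maxchain_ser X :
  maxchain ser_lt (sumset X) = maxchain lt1 X.1 && maxchain lt2 X.2.
Proof.
apply/maxchainP/andP => [h|[/maxchainP h1 /maxchainP h2] [] p].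
- split; apply/maxchainP => p.
  + have := h (inl p).
    by rewrite forall_in_sumset inE /cmp/= !forall_in_true andbT.
  + have := h (inr p).
    by rewrite forall_in_sumset inE /cmp/= !forall_in_true.
- by rewrite forall_in_sumset inE /cmp/= !forall_in_true andbT h1.
- by rewrite forall_in_sumset inE /cmp/= !forall_in_true h2.
Qed.

(** The inhabitants exclude the empty chain, which is maximal in an empty poset:
    it would be counted once for each summand. *)
Lemma maxchain_par (p1 : T1) (p2 : T2) X :
  maxchain par_lt (sumset X) =
  (maxchain lt1 X.1 && (X.2 == finset.set0)) || ((X.1 == finset.set0) && maxchain lt2 X.2).
Proof.
have hl p : [forall q in sumset X, cmp par_lt (inl p) q] =
    [forall q in X.1, cmp lt1 p q] && (X.2 == finset.set0).
  by rewrite forall_in_sumset /cmp/= forall_in_false.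
have hr p : [forall q in sumset X, cmp par_lt (inr p) q] =
    (X.1 == finset.set0) && [forall q in X.2, cmp lt2 p q].
  by rewrite forall_in_sumset /cmp/= forall_in_false.
apply/maxchainP/orP => [h|[/andP[m1 /eqP X2]|/andP[/eqP X1 m2]] [] p].
- have [X2|X2] := eqVneq X.2 finset.set0.
  + left; rewrite andbT; apply/maxchainP => p.
    by have := h (inl p); rewrite hl inE X2 eqxx andbT.
  + right; have X1 : X.1 == finset.set0.
      apply/eqP/setP => p; have := h (inl p).
      by rewrite hl inE (negbTE X2) andbF inE.
    rewrite X1; apply/maxchainP => p.
    by have := h (inr p); rewrite hr inE X1.
- by rewrite hl X2 eqxx andbT inE (maxchainP _ _ m1).
- by rewrite hr (negbTE (maxchain_neq0 p1 m1)) !inE X2 inE.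
- by rewrite hl (negbTE (maxchain_neq0 p2 m2)) !inE X1 inE andbF.
- by rewrite hr X1 eqxx inE (maxchainP _ _ m2).
Qed.

Lemma card_antichains_par :
  #|antichains par_lt| = #|antichains lt1| * #|antichains lt2|.
Proof.
rewrite -cardsX; apply: card_sumset => X.
by rewrite antichain_par [in RHS]inE !inE.
Qed.

Lemma card_antichains_ser :
  #|antichains ser_lt| <= #|antichains lt1| + #|antichains lt2|.
Proof.
pose D1 := finset.setX (antichains lt1) [set finset.set0 : {set T2}].
pose D2 := finset.setX [set finset.set0 : {set T1}] (antichains lt2).
apply: (@leq_trans #|D1 :|: D2|).
  rewrite -(card_imset _ (can_inj sumsetK)); apply: subset_leq_card.
  apply/fintype.subsetP => S; rewrite inE -[S]unsumsetK => /antichain_ser h.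
  by apply: imset_f; rewrite !inE.
apply: (leq_trans (leq_card_setU _ _)).
by rewrite !cardsX !cards1 muln1 mul1n.
Qed.

Lemma card_maxchains_ser :
  #|maxchains ser_lt| = #|maxchains lt1| * #|maxchains lt2|.
Proof.
rewrite -cardsX; apply: card_sumset => X.
by rewrite maxchain_ser [in RHS]inE !inE.
Qed.

Lemma card_maxchains_par (p1 : T1) (p2 : T2) :
  #|maxchains par_lt| = #|maxchains lt1| + #|maxchains lt2|.
Proof.
pose D1 := finset.setX (maxchains lt1) [set finset.set0 : {set T2}].
pose D2 := finset.setX [set finset.set0 : {set T1}] (maxchains lt2).
have -> : #|maxchains lt1| + #|maxchains lt2| = #|D1 :|: D2|.
  rewrite cardsU !cardsX !cards1 muln1 mul1n.
  rewrite (_ : _ :&: _ = finset.set0) ?cards0 ?subn0//.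
  apply/setP => X; rewrite !inE; apply/negP => /andP[/andP[+ _] /andP[/eqP X1 _]].
  by move/(maxchain_neq0 p1); rewrite X1 eqxx.
by apply: card_sumset => X; rewrite (maxchain_par p1 p2) !inE.
Qed.

End Sums.

(** Forgetting the poset and keeping only its numbers of elements, antichains and
    maximal chains turns the construction into arithmetic. *)
Definition realizable (N a x : nat) : Prop :=
  exists (T : finType) (lt : rel T),
    [/\ strict_order lt, #|T| = N, #|antichains lt| = a & #|maxchains lt| = x].

Lemma realizable_par N1 a1 x1 N2 a2 x2 : 0 < N1 -> 0 < N2 ->
  realizable N1 a1 x1 -> realizable N2 a2 x2 ->
  realizable (N1 + N2) (a1 * a2) (x1 + x2).
Proof.
move=> N1_gt0 N2_gt0 [T1 [lt1 [s1 eN1 <- <-]]] [T2 [lt2 [s2 eN2 <- <-]]].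
have /card_gt0P[p1 _] : 0 < #|T1| by rewrite eN1.
have /card_gt0P[p2 _] : 0 < #|T2| by rewrite eN2.
rewrite -eN1 -eN2.
exists (T1 + T2)%type, (par_lt lt1 lt2); split.
- exact: par_strict_order.
- exact: card_sum.
- exact: card_antichains_par.
- exact: (card_maxchains_par _ _ p1 p2).
Qed.

Lemma realizable_ser N1 a1 x1 N2 a2 x2 :
  realizable N1 a1 x1 -> realizable N2 a2 x2 ->
  exists2 a, a <= a1 + a2 & realizable (N1 + N2) a (x1 * x2).
Proof.
move=> [T1 [lt1 [s1 <- <- <-]]] [T2 [lt2 [s2 <- <- <-]]].
exists #|antichains (ser_lt lt1 lt2)|; first exact: card_antichains_ser.
exists (T1 + T2)%type, (ser_lt lt1 lt2); split=> //.
- exact: ser_strict_order.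
- exact: card_sum.
- exact: card_maxchains_ser.
Qed.

Lemma realizable1 : realizable 1 2 1.
Proof.
exists unit, (fun _ _ => false); split.
- by split.
- exact: card_unit.
- have -> : antichains (fun _ _ : unit => false) = powerset [set: unit].
    by apply/setP => A; rewrite !inE finset.subsetT; apply/antichainP.
  by rewrite card_powerset cardsT card_unit.
- rewrite (_ : maxchains _ = [set [set: unit]]) ?cards1//.
  apply/setP => C; rewrite !inE; apply/maxchainP/eqP => [h|-> p].
    apply/setP => -[]; rewrite h inE; apply/forall_inP => -[] _; by rewrite /cmp eqxx.
  by rewrite inE; apply/esym/forall_inP => q _; rewrite /cmp; case: p q => -[].
Qed.

Lemma realizable_copies N a x m : 0 < N -> 0 < m -> realizable N a x ->
  realizable (m * N) (a ^ m) (m * x).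
Proof.
move=> N0; case: m => // m _ h; elim: m => [|m IH]; first by rewrite !mul1n expn1.
by rewrite expnS 2![m.+2 * _]mulSn; apply: realizable_par; rewrite ?muln_gt0 ?N0.
Qed.

(** Replacing H by two disjoint copies of the ordinal sum of H with itself
    multiplies the number of elements by 4, but essentially only squares the two
    other counts: with 4^d elements, both are exponential in 2^d, the square root
    of the number of elements. *)
Lemma realizable_square d : exists2 a,
  a <= 2 ^ (3 * 2 ^ d - 2) & realizable (4 ^ d) a (2 ^ (2 ^ d - 1)).
Proof.
elim: d => [|d [a a_le h]]; first by exists 2 => //; apply: realizable1.
have [b b_le hb] := realizable_ser h h.
have d0 : 0 < 2 ^ d by rewrite expn_gt0.
exists (b * b).
  have b_le' : b <= 2 ^ (3 * 2 ^ d - 1).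
    apply: (leq_trans b_le); rewrite (_ : 3 * 2 ^ d - 1 = (3 * 2 ^ d - 2).+1).
      by rewrite expnS mul2n -addnn leq_add.
    by rewrite -subSn ?subSS// (@leq_trans (3 * 1)) // leq_mul2l.
  apply: (leq_trans (leq_mul b_le' b_le')); rewrite -expnD leq_exp2l//.
  by rewrite addnn -mul2n mulnBr mulnCA -expnS.
have N0 : 0 < 4 ^ d + 4 ^ d by rewrite addn_gt0 expn_gt0.
have := realizable_par N0 N0 hb hb.
rewrite addnn -mul2n addnn -mul2n mulnA -expnS.
set x := _ * 2 ^ (2 ^ d - 1); rewrite (_ : x + x = 2 ^ (2 ^ d.+1 - 1))// /x -expnD.
rewrite !addnn -!mul2n -expnS; congr expn.
by rewrite mulnBr -expnS -subSn ?subSS// -[2 * 1]/(2 ^ 1) leq_exp2l.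
Qed.

(** A maximal chain of an ordinal sum of e two-element antichains chooses one
    element in each, while an antichain lies within one of them. *)
Lemma realizable_tower e : 0 < e ->
  exists2 a, a <= 4 * e & realizable (2 * e) a (2 ^ e).
Proof.
have h2 : realizable 2 4 2 by apply: (@realizable_par 1 2 1 1 2 1) => //; apply: realizable1.
case: e => // e _; elim: e => [|e [a a_le h]]; first by exists 4.
have [b b_le hb] := realizable_ser h2 h; exists b.
  by rewrite (leq_trans b_le)// [4 * e.+2]mulnS leq_add2l.
by rewrite [2 * _]mulnS [2 ^ e.+2]expnS.
Qed.

(** * A poset with prescribed counts *)

Lemma realizable_antichains_gt0 N a x : realizable N a x -> 0 < a.
Proof.
move=> [T [lt [_ _ <- _]]]; apply/card_gt0P; exists finset.set0; rewrite inE.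
by apply/antichainP => p q; rewrite inE.
Qed.

Lemma leq_mul_add4 k A B C D X : k * A <= X -> k * B <= X -> k * C <= X ->
  k * D <= X -> 2 * (k * (A + (B + C + D))) <= 8 * X.
Proof. lia. Qed.

(** The bounds are those of the theorem with c = 16 and c' = 1, free of
    division by k and with n / k rounded down; N + x is the number of facets. *)
Lemma realizable_target n k : 256 <= k -> 2 * (k * k) < n ->
  exists N a x,
    [/\ realizable N a x, n <= 2 * N <= 2 * n,
        2 ^ (16 * (n %/ k)) <= a <= 2 * 2 ^ (16 * (n %/ k)) &
        n * 2 ^ k <= 2 * (k * (N + x)) <= 8 * (n * 2 ^ k)].
Proof.
move=> k_ge n_gt; have k_gt0 : 0 < k by lia.
set q := n %/ k.
have q_le : q * k <= n by exact: leq_divM.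
have q_gt : n < q.+1 * k by exact: ltn_ceil.
have q_ge : 2 * k <= q by rewrite leq_divRL//; clear - n_gt; lia.
clearbody q.
(* D is the power of 2 with k / 8 < D <= k / 4: small enough for blocks of D^2
   elements to fit, large enough for 2^O(n/D) to be 2^O(n/k). *)
have k4 : 0 < k %/ 4 by rewrite divn_gt0//; lia.
have /andP[D_le D_gt] := trunc_log_bounds (isT : 1 < 2) k4.
set d := trunc_log 2 (k %/ 4) in D_le D_gt.
have [a0 a0_le H0] := realizable_square d.
have M_eq : 4 ^ d = 2 ^ d * 2 ^ d by rewrite -expnMn.
rewrite expnS in D_gt; rewrite M_eq in H0.
set D := 2 ^ d in D_le D_gt a0_le H0.
have D_gt0 : 0 < D by rewrite expn_gt0.
clearbody D.
have D_le' : 4 * D <= k by lia.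
have D_gt' : k < 8 * D by lia.
clear D_le D_gt k4 M_eq.
have M_gt0 : 0 < D * D by rewrite muln_gt0 D_gt0.
have M_le : 32 * (D * D) <= n.
  by have := leq_mul D_le' D_le'; lia.
set M := D * D in M_gt0 M_le H0.
pose m := (n %/ (2 * M)).+1.
have mM_le : m * (2 * M) <= n + 2 * M by rewrite /m [_.+1 * _]mulSn addnC leq_add2r leq_divM.
have mM_gt : n < m * (2 * M) by apply: ltn_ceil; rewrite muln_gt0.
have m_le : m <= n by rewrite /m ltn_Pdiv//; clear - M_gt0 M_le; lia.
have m_gt0 : 0 < m by [].
clearbody m.
have H1 := realizable_copies M_gt0 m_gt0 H0.
have Dm_le : 3 * D * m <= 13 * q.
  have h1 : D * m * k <= 8 * (m * M).
    by apply: leq_trans (leq_mul (leqnn _) (ltnW D_gt')) _; rewrite /M; clear; lia.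
  have h2 : 4 * (D * m * k) <= 17 * n by lia.
  have h3 : 4 * (D * m) < 17 * q.+1.
    by rewrite -(ltn_pmul2r k_gt0); lia.
  by rewrite -mulnA; lia.
have a1_le : a0 ^ m <= 2 ^ (13 * q).
  apply: (@leq_trans (2 ^ ((3 * D - 2) * m))); first by rewrite expnM leq_exp2r.
  by rewrite leq_exp2l//; apply: leq_trans Dm_le; rewrite leq_mul2r leq_subr orbT.
clearbody M.
(* 2^t is q up to a factor 2, so that 2^(k + t) is n 2^k / k up to a constant. *)
have q_gt0 : 0 < q by lia.
have /andP[t_le t_gt] := trunc_log_bounds (isT : 1 < 2) q_gt0.
set t := trunc_log 2 q in t_le t_gt.
have t_lt : t < q by apply: leq_trans t_le; apply: ltn_expl.
clearbody t.
have [a2 a2_le H2] := @realizable_tower (k + t) (ltn_addr _ k_gt0).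
have a2_le' : a2 <= 2 ^ q.
  apply: (leq_trans a2_le); apply: (@leq_trans (8 * q)); first by lia.
  rewrite -(@subnK 6 q); last by lia.
  have := @ltn_expl 2 (q - 6) isT; rewrite expnD -[2 ^ 6]/64; lia.

have N1_gt0 : 0 < m * M by rewrite muln_gt0 m_gt0 M_gt0.
have e_gt0 : 0 < 2 * (k + t) by rewrite muln_gt0 addn_gt0 k_gt0.
have H12 := realizable_par N1_gt0 e_gt0 H1 H2.
have W_gt0 := realizable_antichains_gt0 H12.
(* 2^l is the number of antichains so far up to a factor 2; the j isolated
   points multiply it by 2^j. *)
have /andP[l_le l_gt] := trunc_log_bounds (isT : 1 < 2) W_gt0.
have W_le : a0 ^ m * a2 <= 2 ^ (14 * q).
  apply: (leq_trans (leq_mul a1_le a2_le')); rewrite -expnD leq_exp2l//; lia.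
set W := a0 ^ m * a2 in W_gt0 l_le l_gt W_le H12.
set l := trunc_log 2 W in l_le l_gt.
have l_le' : l <= 14 * q by rewrite -(@leq_exp2l 2)// (leq_trans l_le).
pose j := 16 * q - l.
have jl : l + j = 16 * q by rewrite /j; clear - l_le'; lia.
clearbody l j W.
have j_gt0 : 0 < j by clear - jl l_le' q_gt0; lia.
have j_le : j <= 16 * q by clear - jl; lia.
have H3 := realizable_copies (isT : 0 < 1) j_gt0 realizable1.
have j1_gt0 : 0 < j * 1 by rewrite muln1.
have N12_gt0 : 0 < m * M + 2 * (k + t) by rewrite addn_gt0 N1_gt0.
have H := realizable_par N12_gt0 j1_gt0 H12 H3.
have kq : q * 256 <= n by apply: leq_trans q_le; rewrite leq_mul2l k_ge orbT.
eexists _, _, _; split; first exact: H.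
- apply/andP; split; clear - mM_le mM_gt M_le kq q_ge t_lt j_le; lia.
- rewrite -jl expnD; apply/andP; split; first by rewrite leq_mul2r l_le orbT.
  by rewrite mulnA -expnS leq_mul2r (ltnW l_gt) orbT.
- (* Each of the four parts of N + x is at most n 2^k / k, and the 2^(k + t)
     maximal chains of the ordinal sum are at least half of that. *)
  set x1 := m * 2 ^ (D - 1).
  have k2 : k < 2 ^ k by exact: ltn_expl.
  set E := 2 ^ k in k2 *.
  have x1_le : k * x1 <= n * E.
    rewrite /x1 mulnCA leq_mul//.
    apply: (@leq_trans (2 ^ (3 + D + (D - 1)))).
      rewrite [2 ^ (3 + D + _)]expnD leq_mul2r; apply/orP; right.
      apply: leq_trans (ltnW D_gt') _.
      by rewrite expnD; apply: (leq_mul (leqnn (2 ^ 3))); apply: ltnW; apply: ltn_expl.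
    by rewrite leq_exp2l//; lia.
  rewrite expnD -/E; rewrite expnS in t_gt.
  have up : k * (E * 2 ^ t) <= n * E.
    rewrite mulnCA [n * E]mulnC leq_mul2l mulnC; apply/orP; right.
    by apply: leq_trans q_le; rewrite leq_mul2r t_le orbT.
  have low : n * E <= 2 * (k * (E * 2 ^ t)).
    rewrite [2 * _]mulnCA [2 * _]mulnCA mulnCA [n * E]mulnC leq_mul2l mulnC; apply/orP; right.
    by apply: leq_trans (ltnW q_gt) _; rewrite leq_mul2r t_gt orbT.
  have N_le : m * M + 2 * (k + t) + j * 1 <= n by clear - mM_le M_le kq q_ge t_lt j_le; lia.
  have kN : k * (m * M + 2 * (k + t) + j * 1) <= n * E.
    by rewrite mulnC leq_mul// ltnW.
  have kj : k * (j * 1) <= n * E.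
    by apply: leq_trans kN; rewrite leq_mul2l leq_addl orbT.
  apply/andP; split; last exact: leq_mul_add4.
  apply: (leq_trans low); rewrite !leq_mul2l /= orbC.
  by apply/orP; left; rewrite addnCA; apply/leq_trans/leq_addr/leq_trans/leq_addl.
Qed.

Local Open Scope classical_set_scope.
Local Open Scope ring_scope.

(** * Vertices and facets from certificates *)

Lemma card_range_finType (I : finType) (X : Type) (g : I -> X) :
  injective g -> (range g #= `I_#|I|)%card.
Proof.
move=> inj_g; apply: (card_eq_trans (B := [set: I])).
  by apply: inj_card_eq => x y _ _; apply: inj_g.
rewrite card_eq_sym.
apply: (card_eq_trans card_II).
have : (range (@enum_val I I) #= [set: 'I_#|I|])%card.
  by apply: inj_card_eq => x y _ _; apply: enum_val_inj.
rewrite card_eq_sym => /card_eq_trans; apply.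
rewrite (_ : range _ = setT) ?card_eqxx//.
by apply/seteqP; split=> // x _; exists (enum_rank x) => //; rewrite enum_rankK.
Qed.

(** Positivity of finitely many slacks survives a small displacement. *)
Lemma exists_small_scale (R : realFieldType) (J : finType) (P : pred J)
    (g h : J -> R) :
  (forall j, P j -> 0 < g j) ->
  exists2 e : R, 0 < e & forall j, P j -> e * h j <= g j.
Proof.
move=> g_gt0; pose s := \sum_(j | P j) `|h j| / g j.
have term_ge0 j : P j -> 0 <= `|h j| / g j.
  by move=> Pj; rewrite divr_ge0// ltW// g_gt0.
have s_ge0 : 0 <= s by rewrite sumr_ge0.
have s1_gt0 : 0 < 1 + s by rewrite ltr_wpDr.
exists (1 + s)^-1 => [|j Pj]; first by rewrite invr_gt0.
rewrite mulrC ler_pdivrMr//; apply: (le_trans (ler_norm _)).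
rewrite mulrC -ler_pdivrMr ?g_gt0//.
rewrite /s (bigD1 j)//= addrCA lerDl addr_ge0//.
by rewrite sumr_ge0// => i /andP[Pi _]; apply: term_ge0.
Qed.

Section Faces.
Variables (R : realType) (N : nat).
Local Notation V := 'rV[R]_N.
Implicit Types (u x y : V) (S F P : set V).

Definition dot u x : R := \sum_j u 0 j * x 0 j.

Lemma dotD u x y : dot u (x + y) = dot u x + dot u y.
Proof. by rewrite -big_split; apply: eq_bigr => j _; rewrite mxE mulrDr. Qed.

Lemma dotZ u a x : dot u (a *: x) = a * dot u x.
Proof. by rewrite mulr_sumr; apply: eq_bigr => j _; rewrite mxE mulrCA. Qed.

Lemma dotN u x : dot u (- x) = - dot u x.
Proof. by rewrite -scaleN1r dotZ mulN1r. Qed.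

Lemma dotB u x y : dot u (x - y) = dot u x - dot u y.
Proof. by rewrite dotD dotN. Qed.

Lemma dot_comb u k (w : 'I_k -> R) (p : 'I_k -> V) :
  dot u (\sum_i w i *: p i) = \sum_i w i * dot u (p i).
Proof.
have d0 : dot u 0 = 0 by rewrite -(scale0r 0) dotZ mul0r.
rewrite (big_morph (dot u) (dotD u) d0).
by apply: eq_bigr => i _; rewrite dotZ.
Qed.

Lemma dot_is_linear u : linear_for *%R (dot u).
Proof. by move=> a x y; rewrite dotD dotZ. Qed.

HB.instance Definition _ u :=
  GRing.isLinear.Build R V R^o *%R (dot u) (@dot_is_linear u).

Lemma sub_aff_hull S : S `<=` aff_hull S.
Proof.
move=> x Sx; exists 1%N, (fun=> x), (fun=> 1); split=> //; rewrite big_ord1//.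
by rewrite scale1r.
Qed.

Lemma aff_hull_line S x y (t : R) :
  S x -> S y -> aff_hull S ((1 - t) *: x + t *: y).
Proof.
move=> Sx Sy; exists 2%N, (fun i => if i == ord0 then x else y),
  (fun i => if i == ord0 then 1 - t else t); split.
- by move=> i; case: ifP.
- by rewrite !big_ord_recl big_ord0 /= addr0 subrK.
- by rewrite !big_ord_recl big_ord0 /= addr0.
Qed.

(** The affine hull of S contains x + d as soon as S contains x and some point of
    the open ray from x in direction d. *)
Lemma aff_hull_ray S x d (e : R) :
  0 < e -> S x -> S (x + e *: d) -> aff_hull S (x + d).
Proof.
move=> e0 Sx Sd; have := aff_hull_line e^-1 Sx Sd.
by rewrite scalerDr scalerA mulVf ?gt_eqF// scale1r addrA -scalerDl subrK scale1r.
Qed.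

Lemma dot_aff_hull S u b :
  (forall x, S x -> dot u x = b) -> forall x, aff_hull S x -> dot u x = b.
Proof.
move=> h x [k [p [w [Sp w1 ->]]]]; rewrite dot_comb -[RHS]mul1r -w1 mulr_suml.
by apply: eq_bigr => i _; rewrite h.
Qed.

Lemma aff_hull1 x : aff_hull [set x] = [set x].
Proof.
apply/seteqP; split; last exact: sub_aff_hull.
move=> _ [k [p [w [px w1 ->]]]] /=.
rewrite (eq_bigr (fun i => w i *: x)) => [|i _]; last by rewrite px.
by rewrite -scaler_suml w1 scale1r.
Qed.

Lemma aff_hull_neq0 S x : aff_hull S x -> S !=set0.
Proof.
move=> [[|k] [p [w [Sp w1 _]]]]; last by exists (p ord0).
by move: w1; rewrite big_ord0 => /esym/eqP; rewrite oner_eq0.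
Qed.

Lemma has_dim_neq0 S k : has_dim S k -> S !=set0.
Proof.
move=> [x [U [_ e]]]; apply: (@aff_hull_neq0 _ x); rewrite e.
by exists 0; rewrite ?addr0//=; apply: mem0v.
Qed.

Lemma has_dim0P S : has_dim S 0 <-> exists x, S = [set x].
Proof.
split=> [dimS|[x ->]]; last first.
  exists x, 0%VS; split; first exact: dimv0.
  rewrite aff_hull1; apply/seteqP; split=> [y ->|_ [u /= + <-]].
    by exists 0; rewrite ?addr0//=; apply: mem0v.
  by rewrite memv0 => /eqP ->; rewrite addr0.
have [y Sy] := has_dim_neq0 dimS.
case: dimS => x [U [/eqP]]; rewrite dimv_eq0 => /eqP -> e.
have sub z : S z -> z = x.
  move=> /sub_aff_hull; rewrite e => -[u /=].
  by rewrite memv0 => /eqP -> <-; rewrite addr0.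
exists x; apply/seteqP; split=> z /=; first exact: sub.
by move=> ->; rewrite -(sub _ Sy).
Qed.

Lemma conv_hull_sum S (I : finType) (p : I -> V) (w : I -> R) :
  (forall i, S (p i)) -> (forall i, 0 <= w i) -> \sum_i w i = 1 ->
  conv_hull S (\sum_i w i *: p i).
Proof.
move=> Sp w0 w1.
have bij := onW_bij xpredT (@enum_val_bij I).
exists #|I|, (p \o enum_val), (w \o enum_val); split=> //=.
- by rewrite -[RHS]w1 [RHS](reindex (@enum_val I I)).
- by rewrite (reindex (@enum_val I I)).
Qed.

Lemma sub_conv_hull S : S `<=` conv_hull S.
Proof.
move=> x Sx; exists 1%N, (fun=> x), (fun=> 1); split=> //; rewrite big_ord1//.
by rewrite scale1r.
Qed.

Lemma dot_conv_hull_le S u b :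
  (forall x, S x -> dot u x <= b) -> forall x, conv_hull S x -> dot u x <= b.
Proof.
move=> h x [k [p [w [Sp w0 w1 ->]]]].
rewrite dot_comb -[leRHS]mul1r -w1 mulr_suml.
by apply: ler_sum => i _; rewrite ler_wpM2l// h.
Qed.

(** A linear functional bounded by b reaches b at a convex combination only if it
    does so at every point of nonzero weight. *)
Lemma dot_conv_hull_eq u b k (p : 'I_k -> V) (w : 'I_k -> R) :
  (forall i, dot u (p i) <= b) -> (forall i, 0 <= w i) -> \sum_i w i = 1 ->
  dot u (\sum_i w i *: p i) = b -> forall i, w i != 0 -> dot u (p i) = b.
Proof.
move=> h w0 w1 e i wi.
have term0 j : true -> 0 <= w j * (b - dot u (p j)).
  by rewrite mulr_ge0// subr_ge0 h.
have : \sum_j w j * (b - dot u (p j)) = 0.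
  under eq_bigr do rewrite mulrBr.
  by rewrite big_split/= sumrN -mulr_suml w1 mul1r -dot_comb e subrr.
move=> /eqP; rewrite psumr_eq0// => /allP /(_ i (mem_index_enum i)) /=.
by rewrite mulf_eq0 (negbTE wi) /= subr_eq0 => /eqP.
Qed.

(** If every generator p i is the unique maximizer of a functional u i among the
    generators, all of them are vertices; conversely a vertex is a face, which
    contains every generator of nonzero weight in it. *)
Lemma vertices_conv_hull (I : finType) (p : I -> V) (u : I -> V) :
  (forall i j, j != i -> dot (u i) (p j) < dot (u i) (p i)) ->
  (vertices (conv_hull (range p)) #= `I_#|I|)%card.
Proof.
move=> exposed.
have le_p i j : dot (u i) (p j) <= dot (u i) (p i).
  by have [->|/exposed/ltW] := eqVneq j i.
have inj_p : injective p.
  move=> i j e; apply/eqP/negPn/negP; rewrite eq_sym => /exposed.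
  by rewrite e ltxx.
suff -> : vertices (conv_hull (range p)) = range (fun i => [set p i]).
  apply: card_range_finType => i j /seteqP[+ _] => /(_ (p i) erefl).
  exact: inj_p.
apply/seteqP; split=> [F [[a [b [le_b ->]]] /has_dim0P [x eF]]|_ [i _ <-]].
- have : (conv_hull (range p) `&` [set x | dot a x = b]) x by rewrite eF.
  move=> [[k [q [w [rq w0 w1 ex]]]] /= ab].
  have [i wi] : exists i, w i != 0.
    apply/existsP; apply: contraT => /existsPn w00.
    move: w1; rewrite big1 => [/esym/eqP|i _]; first by rewrite oner_eq0.
    by apply/eqP/negPn; apply: w00.
  have qb j : dot a (q j) <= b by apply: le_b; apply: sub_conv_hull.
  have dq : dot a (q i) = b by apply: (dot_conv_hull_eq qb w0 w1) => //; rewrite -ex.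
  have : (conv_hull (range p) `&` [set x | dot a x = b]) (q i).
    by split=> //; apply: sub_conv_hull.
  have [j _ ej] := rq i.
  by rewrite eF => /= qx; exists j => //; rewrite ej qx.
- split; last by apply/has_dim0P; exists (p i).
  have hp x : range p x -> dot (u i) x <= dot (u i) (p i) by move=> [j _ <-].
  exists (u i), (dot (u i) (p i)); split; first exact: dot_conv_hull_le.
  apply/seteqP; split=> [x ->|x [[k [q [w [rq w0 w1 ->]]]] /= e]].
    by split=> //; apply: sub_conv_hull; exists i.
  rewrite -[RHS]scale1r -w1 scaler_suml; apply: eq_bigr => l _.
  have [->|wl] := eqVneq (w l) 0; first by rewrite !scale0r.
  congr (_ *: _).
  have := dot_conv_hull_eq (fun l => hp _ (rq l)) w0 w1 e wl.
  have [j _ <-] := rq l => ej.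
  apply/eqP; apply: contraT => ne; have /exposed : j != i.
    by apply: contra ne => /eqP ->.
  by rewrite ej ltxx.
Qed.

Section Halfspaces.
Variables (I : finType) (a : I -> V) (b : I -> R).

Definition halfspaces : set V := [set x | forall i, dot (a i) x <= b i].

(** A direction can be followed a little way both ways from z when it is parallel
    to every constraint that is tight at z. *)
Lemma halfspaces_move (z d : V) :
  (forall i, dot (a i) z < b i \/ dot (a i) d = 0 /\ dot (a i) z <= b i) ->
  exists2 e : R, 0 < e & halfspaces (z + e *: d) /\ halfspaces (z - e *: d).
Proof.
move=> h; have [|e e0 le] := @exists_small_scale R I
    (fun i => dot (a i) z < b i)
    (fun i => b i - dot (a i) z) (fun i => `|dot (a i) d|).
  by move=> i; rewrite subr_gt0.
exists e => //; split=> i; rewrite ?dotB ?dotD dotZ.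
  have [/le lei|[-> lei]] := h i; last by rewrite mulr0 addr0.
  rewrite addrC -lerBrDr (le_trans _ lei)// ler_wpM2l ?(ltW e0)//.
  exact: ler_norm.
have [/le lei|[-> lei]] := h i; last by rewrite mulr0 subr0.
rewrite addrC -lerBrDr (le_trans _ lei)// -mulrN ler_wpM2l ?(ltW e0)//.
by rewrite -normrN ler_norm.
Qed.

Lemma halfspaces_interior (z : V) :
  (forall i, dot (a i) z < b i) -> interior halfspaces z.
Proof.
move=> hz; have [|e e0 le] := @exists_small_scale R I xpredT
    (fun i => b i - dot (a i) z) (fun i => \sum_j `|a i 0 j|).
  by move=> i _; rewrite subr_gt0.
apply/nbhs_ballP; exists e => //= x [_ zx] i.
rewrite -(subrK z x) dotD -lerBrDr (le_trans _ (le i isT))//.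
rewrite /dot mulr_sumr ler_sum// => j _.
rewrite (le_trans (ler_norm _))// normrM mulrC ler_wpM2r//.
have := zx 0 j; rewrite /ball_ /= !mxE distrC => /ltW; exact.
Qed.

(** [z i] certifies that the i-th constraint is irredundant, and [z0] that the
    polytope is full-dimensional. *)
Variable z : I -> V.
Hypotheses (za : forall i, dot (a i) (z i) = b i)
  (zlt : forall i j, j != i -> dot (a j) (z i) < b j).
Variable z0 : V.
Hypothesis z0lt : forall i, dot (a i) z0 < b i.
Variable i0 : I.

Definition wall i := halfspaces `&` [set x | dot (a i) x = b i].

Lemma wall_inj : injective wall.
Proof.
move=> i j e; apply/eqP/negPn/negP => ij.
have : wall i (z i).
  split=> //= k; have [->|/zlt/ltW//] := eqVneq k i; by rewrite za.
rewrite e => -[_ /= ej].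
by have := zlt (i := i) (j := j); rewrite eq_sym ij ej ltxx => /(_ isT).
Qed.

Definition wall_direction i : {vspace V} := lker (linfun (dot (a i))).

Lemma mem_wall_direction i x : (x \in wall_direction i) = (dot (a i) x == 0).
Proof. by rewrite memv_ker lfunE. Qed.

Lemma dim_wall_direction i : \dim (wall_direction i) = N.-1.
Proof.
have := limg_ker_dim (linfun (dot (a i))) fullv.
rewrite capfv dimvf /dim /= mul1n => e.
have : (\dim (limg (linfun (dot (a i)))) <= 1)%N.
  by have := dimvS (subvf (limg (linfun (dot (a i))))); rewrite dimvf.
have : \dim (limg (linfun (dot (a i)))) != 0%N.
  rewrite dimv_eq0; apply/negP => /eqP l0.
  have : linfun (dot (a i)) (z i - z0) \in limg (linfun (dot (a i))).
    by apply: memv_img; apply: memvf.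
  rewrite l0 memv0 lfunE /= dotB za subr_eq0 => /eqP bi.
  by have := z0lt i; rewrite -bi ltxx.
move: e; rewrite /wall_direction; case: (\dim (limg _)) => // -[|//] e _ _.
exact: (congr1 predn (etrans (esym (addn1 _)) e)).
Qed.

(** Since only the i-th constraint is tight at z i, the wall contains a
    neighbourhood of z i in its hyperplane. *)
Lemma aff_hull_wall i : aff_hull (wall i) = [set z i + u | u in [set` wall_direction i]].
Proof.
have zwall : wall i (z i).
  split=> //= k; have [->|/zlt/ltW//] := eqVneq k i; by rewrite za.
apply/seteqP; split=> [x|_ [d /= + <-]].
  have hb y : wall i y -> dot (a i) y = b i by case.
  move=> /(dot_aff_hull hb) e; exists (x - z i); last by rewrite addrC subrK.
  by rewrite /= mem_wall_direction dotB za e subrr.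
rewrite mem_wall_direction => /eqP d0.
have [k|e e0 [He _]] := @halfspaces_move (z i) d.
  by have [->|/zlt ?] := eqVneq k i; [right; rewrite za d0|left].
have ewall : wall i (z i + e *: d) by split=> //=; rewrite dotD dotZ d0 mulr0 addr0 za.
exact: aff_hull_ray ewall.
Qed.

(** A face through an interior point has a supporting functional that is
    constant, so the face contains a small segment around that point in every
    direction. *)
Lemma full_aff_hull F (y : V) : is_face halfspaces F -> F y ->
  (forall i, dot (a i) y < b i) -> aff_hull F = setT.
Proof.
move=> [u [c [le_c ->]]] [Hy /= yc] ylt; apply/seteqP; split=> // x _.
have [k|e e0 [H1 H2]] := @halfspaces_move y (x - y); first by left.
have u0 : dot u (x - y) = 0.
  have h1 : dot u (y + e *: (x - y)) <= c by apply: le_c.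
  have h2 : dot u (y - e *: (x - y)) <= c by apply: le_c.
  rewrite dotD dotZ [dot u y]yc in h1; rewrite dotB dotZ [dot u y]yc in h2.
  apply/eqP; rewrite eq_le -(ler_pM2l e0) mulr0 -[X in _ && X](ler_pM2l e0) mulr0.
  by apply/andP; split; lra.
have -> : x = y + (x - y) by rewrite addrC subrK.
apply: (aff_hull_ray e0); split=> //=.
by rewrite -/(dot _ _) dotD dotZ u0 mulr0 addr0.
Qed.

Lemma face_convex F k (p : 'I_k.+1 -> V) : is_face halfspaces F ->
  (forall i, F (p i)) -> F (\sum_i k.+1%:R^-1 *: p i).
Proof.
move=> [u [c [le_c ->]]] Fp.
have comb v : dot v (\sum_i k.+1%:R^-1 *: p i) = \sum_i k.+1%:R^-1 * dot v (p i).
  exact: dot_comb.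
have const (r : R) : \sum_(i < k.+1) k.+1%:R^-1 * r = r.
  by rewrite sumr_const card_ord -[LHS]mulr_natl mulrA divff ?mul1r// pnatr_eq0.
split=> [i|/=].
  rewrite comb -[leRHS]const; apply: ler_sum => j _.
  by rewrite ler_wpM2l ?invr_ge0//; case: (Fp j).
by rewrite -/(dot u _) comb -[RHS]const; apply: eq_bigr => j _; case: (Fp j) => _ /= <-.
Qed.

(** Otherwise each constraint is slack at some point of F.  The mean of such
    points lies in F and satisfies all constraints strictly, hence F spans the
    whole space, which is one dimension too many. *)
Lemma face_sub_wall F : (0 < N)%N -> is_face halfspaces F -> has_dim F N.-1 ->
  exists i, F `<=` wall i.
Proof.
move=> N0 faceF dimF; apply: contrapT => /forallNP nsub.
have /choice [y yP] : forall i, exists y, F y /\ dot (a i) y < b i.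
  move=> i; have /existsNP [y /not_implyP [Fy nwall]] := nsub i.
  exists y; split=> //; case: faceF => u [c [_ eF]].
  move: Fy; rewrite eF => -[Hy _]; rewrite lt_neqAle Hy andbT.
  by apply/eqP => e; apply: nwall.
have cardI : #|I| = #|I|.-1.+1 by rewrite prednK//; apply/card_gt0P; exists i0.
pose p (j : 'I_(#|I|.-1.+1)) := y (enum_val (cast_ord (esym cardI) j)).
pose m := \sum_j (#|I|.-1.+1)%:R^-1 *: p j.
have Fm : F m by apply: face_convex => // j; apply: (yP _).1.
have full : aff_hull F = setT.
  apply: (full_aff_hull faceF Fm) => i.
  rewrite dot_comb.
  have -> : b i = \sum_(j < #|I|.-1.+1) (#|I|.-1.+1)%:R^-1 * b i.
    by rewrite sumr_const card_ord -[RHS]mulr_natl mulrA divff ?mul1r// pnatr_eq0.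
  have inF j : dot (a i) (y j) <= b i.
    case: faceF => u [c [_ eF]]; have := (yP j).1; by rewrite eF => -[+ _]; apply.
  rewrite (bigD1 (cast_ord cardI (enum_rank i)))// [ltRHS](bigD1 (cast_ord cardI (enum_rank i)))//=.
  rewrite ltr_leD//.
    by rewrite ltr_pM2l ?invr_gt0// /p cast_ordK enum_rankK; apply: (yP i).2.
  by apply: ler_sum => j _; rewrite ler_wpM2l ?invr_ge0//; apply: inF.
case: dimF => x [U [dimU e]].
have /eqP UT : U == fullv.
  rewrite eqEsubv subvf; apply/subvP => v _; have : aff_hull F (x + v) by rewrite full.
  by rewrite e => -[u /= uU /addrI <-].
move: dimU; rewrite UT dimvf /dim /= mul1n => eN.
have : (N.-1 < N)%N by rewrite prednK.
by rewrite -[X in (X < _)%N]eN ltnn.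
Qed.

(** A facet lies in some wall; having the same dimension, both span the same
    hyperplane, and a face is recovered from its affine hull by intersecting with
    the polytope. *)
Lemma facets_halfspaces : (0 < N)%N -> (facets halfspaces #= `I_#|I|)%card.
Proof.
move=> N0; suff -> : facets halfspaces = range wall by apply: card_range_finType wall_inj.
apply/seteqP; split=> [F [faceF dimF]|_ [i _ <-]]; last first.
  split; first by exists (a i), (b i); split=> // x; apply.
  by exists (z i), (wall_direction i); split; [exact: dim_wall_direction|exact: aff_hull_wall].
have [i sub] := face_sub_wall N0 faceF dimF; exists i => //.
have [x0 Fx0] := has_dim_neq0 dimF.
case: dimF => x [U [dimU e]].
have dirF v : v \in U -> dot (a i) v = 0.
  move=> vU; have hb y : F y -> dot (a i) y = b i by move=> /sub[].
  have /(dot_aff_hull hb) : aff_hull F (x + v) by rewrite e; exists v.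
  have /(dot_aff_hull hb) : aff_hull F x.
    by rewrite e; exists 0; rewrite ?addr0//=; apply: mem0v.
  by rewrite dotD; lra.
have /eqP eU : U == wall_direction i.
  rewrite eqEdim dimU dim_wall_direction leqnn andbT; apply/subvP => v /dirF v0.
  by rewrite mem_wall_direction v0.
apply/seteqP; split=> //.
case: (faceF) => u [c [_ eF]] y [Hy /= yb]; rewrite eF; split=> //.
have hc w : F w -> dot u w = c by rewrite eF => -[].
apply: (dot_aff_hull hc); move: (sub_aff_hull Fx0); rewrite e => -[v /= vU xv].
exists (y - x0 + v).
  rewrite /= memvD// eU mem_wall_direction dotB yb; move/sub: Fx0 => [_ /= ->].
  by rewrite subrr.
by rewrite addrCA xv subrK.
Qed.

End Halfspaces.
End Faces.

(** * Chain polytopes *)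

Section ChainPolytope.
Variables (R : realType) (T : finType) (lt : rel T).
Hypothesis lt_order : strict_order lt.
Implicit Types (g h : T -> R) (A C : {set T}) (p q : T).

(** Let M be the set of minimal elements of the support of g and let m be the
    minimum of g on M.  Subtracting m on M shrinks the support, and it lowers the
    bound on chain sums to s - m: a chain of the support either meets M or can be
    extended downwards by an element of M, where g is at least m. *)
Lemma antichain_decomposition g (s : R) : 0 <= s -> (forall p, 0 <= g p) ->
  (forall C, chain lt C -> \sum_(p in C) g p <= s) ->
  exists w : {set T} -> R,
    [/\ forall A, 0 <= w A, forall A, w A != 0 -> antichain lt A,
        \sum_A w A = s & forall p, g p = \sum_A w A * (p \in A)%:R].
Proof.
pose supp g := [set p | g p != 0]%SET.
have [n] := ubnP #|supp g|; elim: n g s => // n IH g s le_n s0 g0 chain_le.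
have [supp0|[p0 p0supp]] := set_0Vmem (supp g).
  exists (fun A => if A == finset.set0 then s else 0); split.
  - by move=> A; case: ifP.
  - move=> A; case: ifP => [/eqP -> _|_]; last by rewrite eqxx.
    by apply/antichainP => p q; rewrite inE.
  - by rewrite -big_mkcond big_pred1_eq.
  - move=> p; rewrite big1 => [|A _].
      have : p \notin supp g by rewrite supp0 inE.
      by rewrite inE negbK => /eqP.
    by case: ifP => [/eqP ->|_]; rewrite ?mul0r// inE mulr0.
pose M := [set p in supp g | [forall q in supp g, ~~ lt q p]]%SET.
have MP p : p \in M -> g p != 0 /\ {in supp g, forall q, ~~ lt q p}.
  by rewrite !inE => /andP[-> /forall_inP].
have below p : p \in supp g -> exists2 a, a \in M & (a == p) || lt a p.
  move=> psupp; have [a [asupp ap amin]] := exists_minimal lt_order psupp.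
  by exists a => //; rewrite inE asupp; apply/forall_inP.
have Mac : antichain lt M.
  by apply/antichainP => p q /MP[gp _] /MP[_]; apply; rewrite inE.
have [a0 a0M _] := below _ p0supp.
pose m := [arg min_(p < a0 in M) g p]%O.
have [mM m_le] : m \in M /\ forall p, p \in M -> g m <= g p.
  by rewrite /m; case: arg_minP.
have gm0 : 0 < g m by rewrite lt_neqAle g0 andbT eq_sym; have [] := MP _ mM.
pose g' p := g p - g m * (p \in M)%:R.
have g'0 p : 0 <= g' p.
  rewrite /g' subr_ge0; case: (boolP (p \in M)) => [/m_le|_]; first by rewrite mulr1.
  by rewrite mulr0.
have g'_supp p : g' p != 0 -> g p != 0.
  apply: contra => /eqP gp; rewrite eq_le g'0 andbT /g' gp.
  by rewrite sub0r oppr_le0 mulr_ge0// ltW.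
have card_supp : (#|supp g'| < n)%N.
  rewrite ltnS in le_n; apply: leq_trans le_n; apply: proper_card; apply/properP; split.
    by apply/fintype.subsetP => p; rewrite !inE; apply: g'_supp.
  exists m; rewrite inE; first by have [] := MP _ mM.
  by rewrite /g' mM mulr1 subrr eqxx.
have g1_le p : g p <= s.
  have -> : g p = \sum_(q in [set p]%SET) g q by rewrite big_set1.
  rewrite chain_le//; apply/chainP => x y.
  by rewrite !inE => /eqP -> /eqP ->; rewrite /cmp eqxx.
(* The chain extended by a, an element of M below it (or in it), bounds the
   sum of g' over the chain. *)
have sum_g' C : chain lt C -> \sum_(p in C) g' p <= s - g m.
  move=> chC; pose D := (C :&: supp g')%SET.
  have chD : chain lt D.
    by apply/chainP => x y /setIP[xC _] /setIP[yC _]; apply: (chainP _ _ chC).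
  have -> : \sum_(p in C) g' p = \sum_(p in D) g' p.
    rewrite (big_setID (supp g'))/= [X in _ + X]big1 ?addr0// => p.
    by rewrite !inE => /andP[/negbNE/eqP].
  have D_supp p : p \in D -> p \in supp g by move=> /setIP[_]; rewrite !inE => /g'_supp.
  have [D0|[c0 c0D]] := set_0Vmem D; first by rewrite D0 big_set0 subr_ge0.
  have [c [cD _ cmin]] := exists_minimal lt_order c0D.
  have [a aM ac] := below c (D_supp _ cD).
  have cmp_a q : q \in D -> (a == q) || lt a q.
    move=> qD; have := chainP _ _ chD _ _ cD qD.
    rewrite /cmp (negbTE (cmin _ qD)) orbF => /orP[/eqP <- //|cq].
    case/orP: ac => [/eqP ->|ac]; first by rewrite cq orbT.
    by rewrite (lt_order.2 _ _ _ ac cq) orbT.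
  have ch_aD : chain lt (a |: D).
    apply: chainU1 => // q /cmp_a; rewrite /cmp => /orP[->//|->].
    by rewrite orbT.
  have := chain_le _ ch_aD; rewrite (big_setD1 a) ?setU11//=.
  have -> : ((a |: D) :\ a = D :\ a)%SET by apply/setP => x; rewrite !inE; case: eqP.
  have := m_le _ aM.
  have -> : \sum_(p in D) g' p =
      \sum_(p in (D :\ a)%SET) g' p + (if a \in D then g' a else 0).
    case: ifP => aD; first by rewrite (big_setD1 a)//= addrC.
    by rewrite addr0; apply: eq_bigl => x; rewrite in_setD1; case: eqP => // ->.
  have : \sum_(p in (D :\ a)%SET) g' p <= \sum_(p in (D :\ a)%SET) g p.
    by apply: ler_sum => p _; rewrite gerBl mulr_ge0// ltW.
  by case: ifP => _; rewrite /g' ?aM ?mulr1; lra.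
have sm0 : 0 <= s - g m by rewrite subr_ge0.
have [w [w0 wac w1 wg]] := IH g' _ card_supp sm0 g'0 sum_g'.
exists (fun A => w A + g m * (A == M)%:R); split.
- by move=> A; rewrite addr_ge0// mulr_ge0// ltW.
- by move=> A; have [->//|_] := eqVneq A M; rewrite mulr0 addr0; apply: wac.
- rewrite big_split/= w1 (bigD1 M)//= eqxx mulr1 big1 ?addr0 ?subrK// => A.
  by move=> /negbTE ->; rewrite mulr0.
- move=> p; under eq_bigr do rewrite mulrDl.
  rewrite big_split/= -wg (bigD1 M)//= eqxx mulr1 big1 ?addr0 ?subrK// => A.
  by move=> /negbTE ->; rewrite mulr0 mul0r.
Qed.

Definition row_of g : 'rV[R]_#|T| := \row_j g (enum_val j).

Lemma dot_row_of g (x : 'rV[R]_#|T|) :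
  dot (row_of g) x = \sum_p g p * x 0 (enum_rank p).
Proof.
rewrite [RHS](reindex (@enum_val T T)); last exact: onW_bij (@enum_val_bij T).
by apply: eq_bigr => j _; rewrite mxE enum_valK.
Qed.

Lemma row_ofE g p : row_of g 0 (enum_rank p) = g p.
Proof. by rewrite mxE enum_rankK. Qed.

Definition indicator A : 'rV[R]_#|T| := row_of (fun p => (p \in A)%:R).

Lemma dot_indicator A (x : 'rV[R]_#|T|) : dot (indicator A) x = \sum_(p in A) x 0 (enum_rank p).
Proof.
rewrite dot_row_of [RHS]big_mkcond; apply: eq_bigr => p _.
by case: ifP; rewrite ?mul1r ?mul0r.
Qed.

Definition wall_vec (i : T + {C | maxchain lt C}) : 'rV[R]_#|T| :=
  match i with inl p => - indicator [set p]%SET | inr C => indicator (val C) end.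

Definition wall_val (i : T + {C | maxchain lt C}) : R :=
  match i with inl _ => 0 | inr _ => 1 end.

Definition chain_polytope := halfspaces wall_vec wall_val.

Lemma dot_wall_vec_inl p (x : 'rV[R]_#|T|) : dot (wall_vec (inl p)) x = - x 0 (enum_rank p).
Proof.
have -> : x 0 (enum_rank p) = dot (indicator [set p]%SET) x by rewrite dot_indicator big_set1.
rewrite /= /dot -sumrN.
by apply: eq_bigr => j _; rewrite mxE mulNr.
Qed.

(** The inequalities for maximal chains imply those for all chains, to which the
    decomposition into antichains applies; conversely a chain and an antichain
    share at most one element. *)
Lemma chain_polytopeE :
  chain_polytope = conv_hull (range (fun A : {A | antichain lt A} => indicator (val A))).
Proof.
apply/seteqP; split=> [x hx|x hx].
- pose g p : R := x 0 (enum_rank p).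
  have g0 p : 0 <= g p.
    by have := hx (inl p); rewrite dot_wall_vec_inl oppr_le0.
  have [C /chain_sub_maxchain[C' mC' sub]|w [w0 wac w1 wg]] :=
      @antichain_decomposition g 1 ler01 g0.
    have := hx (inr (exist _ C' mC')); rewrite /= dot_indicator; apply: le_trans.
    by rewrite [leRHS](big_setID C)/= (finset.setIidPr sub) lerDl sumr_ge0// => p _; apply: g0.
  have ac0 : antichain lt finset.set0 by apply/antichainP => p q; rewrite inE.
  pose A0 : {A | antichain lt A} := exist _ finset.set0 ac0.
  have -> : x = \sum_A w A *: indicator (val (insubd A0 A)).
    apply/rowP => j; rewrite summxE -[j]enum_valK -/(g _) wg.
    apply: eq_bigr => A _; rewrite mxE row_ofE.
    have [->|/wac acA] := eqVneq (w A) 0; first by rewrite !mul0r.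
    by rewrite val_insubd acA.
  by apply: conv_hull_sum => // A; exists (insubd A0 A).
- move=> i; apply: (dot_conv_hull_le _ hx) => _ [[A acA] _ <-] /=.
  case: i => [p|[C mC]] /=; first by rewrite dot_wall_vec_inl row_ofE oppr_le0.
  rewrite dot_indicator; under eq_bigr do rewrite row_ofE.
  have -> : \sum_(p in C) (p \in A)%:R = #|C :&: A|%:R :> R.
    rewrite -sumr_const big_mkcond [RHS]big_mkcond; apply: eq_bigr => p _.
    by rewrite inE; case: (p \in C); case: (p \in A).
  rewrite lern1; apply/card_le1_eqP => p q /setIP[pC pA] /setIP[qC qA].
  exact: (antichain_meets_chain acA (maxchain_chain mC)).
Qed.

Lemma vertices_chain_polytope :
  (vertices chain_polytope #= `I_#|antichains lt|)%card.
Proof.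
rewrite chain_polytopeE.
have -> : #|antichains lt| = #|{: {A | antichain lt A}}|.
  by rewrite card_sig; apply: eq_card => A; rewrite !inE.
(* The functional equal to 1 on A and -1 off A is maximal at the indicator of A
   among all indicators of sets. *)
apply: (@vertices_conv_hull R #|T| {A | antichain lt A} _
  (fun A : {A | antichain lt A} => row_of (fun p => if p \in val A then 1 else -1))).
move=> [A acA] [B acB]; rewrite -val_eqE /= => BA.
rewrite !dot_row_of -subr_gt0 -sumrB.
have [p pAB] : exists p, (p \in A) != (p \in B).
  apply/existsP; apply: contraNT BA => /existsPn h; apply/eqP/setP => p.
  by have /negPn/eqP := h p.
rewrite (bigD1 p)//= ltr_wpDr//.
  apply: sumr_ge0 => q _; rewrite !row_ofE.
  by case: (q \in A); case: (q \in B); rewrite ?(mulr1, mulr0, subrr, sub0r, opprK, subr0).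
rewrite !row_ofE; move: pAB.
by case: (p \in A); case: (p \in B) => //; rewrite ?(mulr1, mulr0, subrr, sub0r, opprK, subr0).
Qed.

Hypothesis T_gt0 : (0 < #|T|)%N.

Lemma interior_sum (e : R) C : 0 <= e -> e * #|T|%:R < 1 ->
  \sum_(p in C) e < 1.
Proof.
move=> e0; apply: le_lt_trans; rewrite sumr_const -[e *+ _]mulr_natr ler_wpM2l//.
by rewrite ler_nat max_card.
Qed.

(** Small enough for a function that is eps off a chain C to have sums less than
    1 over the other maximal chains, even if its sum over C is 1. *)
Definition eps : R := #|T|.+1%:R^-1 ^+ 2.

Lemma eps_gt0 : 0 < eps. Proof. by rewrite exprn_gt0// invr_gt0. Qed.

Lemma eps_lt C : (0 < #|C|)%N -> eps * #|T|%:R < #|C|%:R^-1.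
Proof.
move=> C0; have CR : 0 < #|C|%:R :> R by rewrite ltr0n.
have lt1 A : #|T|.+1%:R^-1 * #|A|%:R < 1 :> R.
  by rewrite mulrC ltr_pdivrMr// mul1r ltr_nat ltnS max_card.
rewrite -[ltRHS]mul1r ltr_pdivlMr//.
have -> : eps * #|T|%:R * #|C|%:R =
    (#|T|.+1%:R^-1 * #|[set: T]%SET|%:R) * (#|T|.+1%:R^-1 * #|C|%:R).
  by rewrite /eps expr2 cardsT; ring.
by rewrite mulr_ilt1// mulr_ge0// invr_ge0.
Qed.

Lemma eps_lt1 : eps * #|T|%:R < 1.
Proof.
apply: (lt_le_trans (@eps_lt [set: T]%SET _)); rewrite ?cardsT//.
by rewrite invf_le1 ?ler1n ?ltr0n.
Qed.

Definition center : 'rV[R]_#|T| := row_of (fun=> eps).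

(** Interior points moved to a single wall: the center with one coordinate
    replaced by 0, or the uniform distribution on a maximal chain perturbed by eps
    elsewhere. *)
Definition wall_pt (i : T + {C | maxchain lt C}) : 'rV[R]_#|T| :=
  match i with
  | inl p => row_of (fun q => if q == p then 0 else eps)
  | inr C => row_of (fun q => if q \in val C then #|val C|%:R^-1 else eps)
  end.

Lemma center_lt i : dot (wall_vec i) center < wall_val i.
Proof.
case: i => [p|C]; first by rewrite dot_wall_vec_inl row_ofE oppr_lt0 eps_gt0.
rewrite /= dot_indicator; under eq_bigr do rewrite row_ofE.
by apply: interior_sum (ltW eps_gt0) eps_lt1.
Qed.

Lemma wall_pt_on i : dot (wall_vec i) (wall_pt i) = wall_val i.
Proof.
case: i => [p|[C mC]]; first by rewrite dot_wall_vec_inl row_ofE eqxx oppr0.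
rewrite /= dot_indicator; under eq_bigr => p pC do rewrite row_ofE pC.
have /card_gt0P[p _] := T_gt0; have C0 := maxchain_neq0 p mC.
by rewrite sumr_const -[LHS]mulr_natr mulVf// pnatr_eq0 cards_eq0.
Qed.

Lemma wall_pt_off i j : j != i -> dot (wall_vec j) (wall_pt i) < wall_val j.
Proof.
have /card_gt0P[p0 _] := T_gt0.
case: i => [p|[C mC]]; case: j => [q|[D mD]].
- move=> qp; have /negbTE pq : q != p := qp.
  by rewrite dot_wall_vec_inl row_ofE pq oppr_lt0 eps_gt0.
- move=> _ /=; rewrite dot_indicator; apply: le_lt_trans (interior_sum D (ltW eps_gt0) eps_lt1).
  by apply: ler_sum => q _; rewrite row_ofE; case: ifP => // _; apply: ltW eps_gt0.
- move=> _; rewrite dot_wall_vec_inl row_ofE oppr_lt0; case: ifP => _; last exact: eps_gt0.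
  by rewrite invr_gt0 ltr0n card_gt0 (maxchain_neq0 p0 mC).
- move=> DC'; have DC : D != C := DC'; rewrite /= dot_indicator.
  have C_gt0 : (0 < #|C|)%N by rewrite card_gt0 (maxchain_neq0 p0 mC).
  rewrite (big_setID C)/=.
  have -> : \sum_(p in (D :&: C)%SET)
      row_of (fun q => if q \in C then #|C|%:R^-1 else eps) 0 (enum_rank p) = #|D :&: C|%:R * #|C|%:R^-1.
    under eq_bigr => p /setIP[_ pC] do rewrite row_ofE pC.
    by rewrite sumr_const mulr_natl.
  have -> : \sum_(p in (D :\: C)%SET)
      row_of (fun q => if q \in C then #|C|%:R^-1 else eps) 0 (enum_rank p) = #|D :\: C|%:R * eps.
    under eq_bigr => p /setDP[_ /negbTE pC] do rewrite row_ofE pC.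
    by rewrite sumr_const mulr_natl.
  (* Another maximal chain misses an element of C, hence loses at least 1 / #|C|,
     more than the perturbation can add. *)
  have ltC : (#|D :&: C|.+1 <= #|C|)%N.
    apply: proper_card; rewrite finset.properEneq finset.subsetIr andbT.
    apply: contra DC => /eqP e; rewrite eq_sym; apply/eqP/(maxchain_antisym mC mD).
    by rewrite -e finset.subsetIl.
  have CR : 0 < #|C|%:R :> R by rewrite ltr0n.
  have le1 : #|D :&: C|%:R * #|C|%:R^-1 <= 1 - #|C|%:R^-1 :> R.
    rewrite -[X in X - _](mulfV (lt0r_neq0 CR)).
    rewrite -[X in _ - X]mul1r -mulrBl ler_pM2r ?invr_gt0// lerBrDr natr1 ler_nat.
    exact: ltC.
  have le2 : #|D :\: C|%:R * eps <= eps * #|T|%:R.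
    by rewrite mulrC ler_pM2l ?eps_gt0// ler_nat max_card.
  have := eps_lt C_gt0; lra.
Qed.

Lemma facets_chain_polytope :
  (facets chain_polytope #= `I_(#|T| + #|maxchains lt|))%card.
Proof.
have -> : (#|T| + #|maxchains lt|)%N = #|{: T + {C | maxchain lt C}}|.
  by rewrite card_sum card_sig; congr addn; apply: eq_card => C; rewrite !inE.
have /card_gt0P[p0 _] := T_gt0.
exact: (facets_halfspaces wall_pt_on wall_pt_off center_lt (inl p0)).
Qed.

Lemma is_polytope_chain_polytope : is_polytope chain_polytope.
Proof.
split; last by exists center; apply: halfspaces_interior; apply: center_lt.
exists (range (fun A : {A | antichain lt A} => indicator (val A))); last exact: chain_polytopeE.
exact/finite_image/finite_finset.
Qed.

End ChainPolytope.

Lemma realizable_polytope (R : realType) N a x : (0 < N)%N -> realizable N a x ->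
  exists P : set 'rV[R]_N,
    [/\ is_polytope P, (vertices P #= `I_a)%card & (facets P #= `I_(N + x))%card].
Proof.
move=> N0 [T [lt [ltP eN <- <-]]]; case: _ / eN N0 => T_gt0.
exists (@chain_polytope R T lt); split.
- exact: is_polytope_chain_polytope.
- exact: vertices_chain_polytope.
- exact: facets_chain_polytope.
Qed.

(** * Logarithms of the counts *)

Section Estimates.
Variable R : realType.
Local Notation L := (ln 2 : R).

Lemma ln2_le1 : L <= 1.
Proof.
have -> : (2 : R) = 1 + 1 by ring.
by apply: le_ln1Dx; lra.
Qed.

Lemma ln2_ge : 1 / 2 <= L.
Proof.
have h : ln (1 + - (1 / 2)) <= - (1 / 2) :> R by apply: le_ln1Dx; lra.
have e : 1 + - (1 / 2) = 2^-1 :> R by lra.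
by rewrite e lnV ?posrE// in h; lra.
Qed.

Lemma ln_exp2 (m : nat) : ln (2 ^+ m) = m%:R * L :> R.
Proof. by rewrite lnXn// mulr_natl. Qed.

Lemma le_ln (x y : R) : 0 < x -> x <= y -> ln x <= ln y.
Proof. by move=> x0 xy; rewrite ler_ln// posrE// (lt_le_trans x0). Qed.

Variables n k : nat.
Local Notation q := (n %/ k)%N.
Local Notation nr := (n%:R : R).
Local Notation kr := (k%:R : R).
Local Notation A := (nr / kr).

Hypothesis k_ge : (256 <= k)%N.

Lemma k_gt0 : 0 < kr.
Proof. by rewrite ltr0n (leq_trans _ k_ge). Qed.

Lemma quotient_bounds : q%:R <= A /\ A < q%:R + 1.
Proof.
split; first by rewrite ler_pdivlMr ?k_gt0// -natrM ler_nat leq_divM.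
by rewrite ltr_pdivrMr ?k_gt0// natr1 -natrM ltr_nat ltn_ceil// -(ltr0n R) k_gt0.
Qed.

Lemma v_real v : (2 ^ (16 * q) <= v <= 2 * 2 ^ (16 * q))%N ->
  2 ^+ (16 * q) <= v%:R :> R /\ v%:R <= 2 * 2 ^+ (16 * q) :> R.
Proof. by case/andP=> v1 v2; rewrite -natrX -natrM !ler_nat. Qed.

Lemma phi_real phi : (n * 2 ^ k <= 2 * (k * phi) <= 8 * (n * 2 ^ k))%N ->
  nr * 2 ^+ k <= 2 * (kr * phi%:R) /\
  2 * (kr * phi%:R) <= 8 * (nr * 2 ^+ k).
Proof. by case/andP=> p1 p2; rewrite -natrX -!natrM !ler_nat. Qed.

Lemma vertices_comparable v : (2 ^ (16 * q) <= v <= 2 * 2 ^ (16 * q))%N ->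
  comparable_with (2 ^- 16) 136 v%:R (2 `^ (16 * A)).
Proof.
move=> v_bounds; have [q1 q2] := quotient_bounds; have [v1 v2] := v_real v_bounds.
have lo : 2 ^+ (16 * q) <= 2 `^ (16 * A) :> R.
  by rewrite -powR_mulrn// ler_powR ?natrM; lra.
have hi : 2 `^ (16 * A) <= 2 ^+ 16 * 2 ^+ (16 * q) :> R.
  by rewrite -exprD -powR_mulrn// ler_powR ?natrD ?natrM; lra.
split.
  rewrite mulrC ler_pdivrMr ?exprn_gt0//; apply: (le_trans hi).
  by rewrite mulrC ler_pM2r ?exprn_gt0.
have := exprn_gt0 (16 * q) (ltr0Sn R 1); lra.
Qed.

Hypothesis n_gt : (2 * (k * k) < n)%N.

Lemma n_gt0 : 0 < nr.
Proof. by rewrite ltr0n (leq_trans _ n_gt). Qed.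

Lemma q_ge1 : 1 <= q%:R :> R.
Proof.
have k0 : (0 < k)%N by rewrite -(ltr0n R) k_gt0.
by rewrite ler1n leq_divRL// mul1n (leq_trans _ (ltnW n_gt))// mulnA leq_pmull// muln_gt0 k0.
Qed.

Lemma facets_comparable phi : (n * 2 ^ k <= 2 * (k * phi) <= 8 * (n * 2 ^ k))%N ->
  comparable_with (2 ^- 16) 136 phi%:R (nr * (2 `^ (1 * kr) / kr)).
Proof.
move=> phi_bounds; have [p1 p2] := phi_real phi_bounds; have k0 := k_gt0; have n0 := n_gt0.
rewrite mul1r powR_mulrn//; set E : R := 2 ^+ k in p1 p2 *.
have E0 : 0 < E by rewrite exprn_gt0.
have e : kr * (nr * (E / kr)) = nr * E by field; lra.
have X0 : 0 < nr * (E / kr) by rewrite mulr_gt0// divr_gt0.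
set X := nr * (E / kr) in e X0 *.
have h1 : X <= 2 * phi%:R by rewrite -(ler_pM2l k0) e; lra.
have h2 : phi%:R <= 4 * X by rewrite -(ler_pM2l k0); lra.
split; last by lra.
have : 2 ^- 16 <= 2^-1 :> R by rewrite lef_pV2 ?posrE ?exprn_gt0// -[leLHS]expr1 ler_eXn2l// ltr1n.
by move=> h; apply: (@le_trans _ _ (2^-1 * X)); [rewrite ler_pM2r|lra].
Qed.

(** Both sides are of the order of (n / k) (k + ln n): the left one since
    ln v is of the order of n / k and ln phi of the order of k + ln n, where
    k^2 <= n keeps ln k below half of ln n; the right one since N is of the order
    of n. *)
Lemma logs_comparable N v phi : (n <= 2 * N <= 2 * n)%N ->
  (2 ^ (16 * q) <= v <= 2 * 2 ^ (16 * q))%N ->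
  (n * 2 ^ k <= 2 * (k * phi) <= 8 * (n * 2 ^ k))%N ->
  comparable_with (2 ^- 16) 136 (ln v%:R * ln phi%:R)
    (N%:R * (1 + ln N%:R / kr)).
Proof.
move=> N_bounds v_bounds phi_bounds.
have k0 := k_gt0; have n0 := n_gt0.
have [q1 q2] := quotient_bounds; have qge := q_ge1.
have L1 := ln2_le1; have L2 := ln2_ge.
have kge : 256 <= kr by rewrite (ler_nat _ 256).
have A0 : 0 < A by rewrite divr_gt0.
have [v1 v2] := v_real v_bounds; have [p1 p2] := phi_real phi_bounds.
have P0 m : 0 < 2 ^+ m :> R by rewrite exprn_gt0.
have v0 : 0 < v%:R :> R by apply: lt_le_trans v1.
have lv1 : 4 * A <= ln v%:R.
  have := le_ln (P0 _) v1; rewrite ln_exp2 natrM.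
  have : q%:R * (1 / 2) <= q%:R * L by rewrite ler_pM2l//; lra.
  lra.
have lv2 : ln v%:R <= 17 * A.
  have := le_ln v0 v2; rewrite -exprS ln_exp2 -natr1 natrM.
  have : q%:R * L <= q%:R * 1 by rewrite ler_pM2l//; lra.
  lra.
have phi0 : 0 < phi%:R :> R.
  have := lt_le_trans (mulr_gt0 n0 (P0 k)) p1.
  by rewrite pmulr_rgt0// pmulr_rgt0.
have nge : 2 * kr ^+ 2 <= nr by rewrite expr2 -!natrM ler_nat ltnW.
have lk0 : 0 <= ln kr by rewrite ln_ge0//; lra.
have lnk : 2 * ln kr <= ln nr.
  have -> : 2 * ln kr = ln (kr ^+ 2) by rewrite lnXn// mulr_natl.
  by apply: le_ln; [rewrite exprn_gt0|have := sqr_ge0 kr; lra].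
have kL : kr * (1 / 2) <= kr * L by rewrite ler_pM2l.
have kL' : kr * L <= kr * 1 by rewrite ler_pM2l.
have lp1 : ln nr / 2 + kr / 4 <= ln phi%:R.
  have := le_ln (mulr_gt0 n0 (P0 k)) p1.
  by rewrite !lnM ?posrE ?mulr_gt0// ln_exp2; lra.
have lp2 : ln phi%:R <= ln nr + 2 * kr.
  have h : kr * phi%:R <= 2 ^+ 2 * (nr * 2 ^+ k) by rewrite expr2; lra.
  have := le_ln (mulr_gt0 k0 phi0) h.
  by rewrite !lnM ?posrE ?mulr_gt0// !ln_exp2; lra.
have [N1 N2] : nr <= 2 * N%:R /\ N%:R <= nr.
  have /andP[h1 h2] := N_bounds; rewrite -natrM !ler_nat; split=> //.
  by rewrite leq_pmul2l in h2.
have N0 : 0 < N%:R :> R by lra.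
have lN1 : ln nr - 1 <= ln N%:R.
  have := le_ln n0 N1; rewrite lnM ?posrE//; lra.
have lN2 : ln N%:R <= ln nr := le_ln N0 N2.
have -> : N%:R * (1 + ln N%:R / kr) = N%:R / kr * (kr + ln N%:R) by field; lra.
set S := kr + ln nr.
have S0 : 0 < S by rewrite /S; lra.
have B1 : N%:R / kr * (kr + ln N%:R) <= A * S.
  apply: ler_pM; rewrite ?ler_pM2r ?invr_gt0//; first by lra.
  by rewrite /S; lra.
have B2 : A * S <= 4 * (N%:R / kr * (kr + ln N%:R)).
  have -> : 4 * (N%:R / kr * (kr + ln N%:R)) = 2 * N%:R / kr * (2 * (kr + ln N%:R)).
    by field; lra.
  apply: ler_pM; rewrite ?ler_pM2r ?invr_gt0//; rewrite ?ltW//.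
  by rewrite /S; lra.
have C1 : A * S <= ln v%:R * ln phi%:R.
  have -> : A * S = 4 * A * (S / 4) by field; lra.
  by rewrite ler_pM//; rewrite /S; lra.
have C2 : ln v%:R * ln phi%:R <= 34 * (A * S).
  have -> : 34 * (A * S) = 17 * A * (2 * S) by field; lra.
  by rewrite ler_pM//; rewrite /S; lra.
set B := N%:R / kr * _ in B1 B2 *.
have AS0 : 0 < A * S by rewrite mulr_gt0.
split; last by lra.
apply: le_trans C1; apply: le_trans B1.
rewrite mulrC ler_pdivrMr// ler_peMr//; first by lra.
by rewrite exprn_ege1//; lra.
Qed.

End Estimates.

Theorem proposition4p2 (R : realType) :
  exists c c' C1 C2 : R,
    [/\ 0 < c, 0 < c', 0 < C1 & 0 < C2] /\
    forall f : nat -> int,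
      ((f n)%:~R : R) @[n --> \oo] --> +oo ->
      (forall n : nat, (0 < n)%N ->
        (f n)%:~R < Num.sqrt (n%:R / 2) :> R) ->
      \forall n \near \oo,
        exists (N : nat) (P : set 'rV[R]_N) (v phi : nat),
          [/\ n%:R / 2 <= N%:R :> R, (N <= n)%N & is_polytope P] /\
          [/\ (vertices P #= `I_v)%card,
              (facets P #= `I_phi)%card,
              comparable_with C1 C2 v%:R
                (2 `^ (c * (n%:R / (f n)%:~R))),
              comparable_with C1 C2 phi%:R
                (n%:R * (2 `^ (c' * (f n)%:~R) / (f n)%:~R)) &
              comparable_with C1 C2 (ln v%:R * ln phi%:R)
                (N%:R * (1 + ln N%:R / (f n)%:~R))].
Proof.
(* c is 16 because of the exponents in [realizable_target]; 2^16 is the loss in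
   rounding n / k down, and 136 = 17 * 2 * 4 comes from the logarithms. *)
exists 16, 1, (2 ^- 16), 136; split; first by split; rewrite ?invr_gt0 ?exprn_gt0.
move=> f /cvgryPge f_oo f_lt; near=> n.
have f_ge : 256 <= (f n)%:~R :> R by near: n; exact: f_oo.
have n_gt0 : (0 < n)%N by near: n; exact: nbhs_infty_gt.
have := f_lt n n_gt0; case: (f n) f_ge => k; last first.
  by rewrite NegzE mulrNz => f_ge; have := ler0n R k.+1; lra.
rewrite -[k%:~R]/(k%:R) (ler_nat _ 256) => k_ge k_lt.
have {k_lt} n_gt : (2 * (k * k) < n)%N.
  have n2 : 0 <= n%:R / 2 :> R by rewrite divr_ge0.
  have : (k%:R : R) ^+ 2 < n%:R / 2.
    by rewrite -(sqr_sqrtr n2) ltr_pXn2r ?nnegrE.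
  by rewrite ltr_pdivlMr// expr2 -!natrM ltr_nat mulnC.
have [N [v [x [H N_bounds v_bounds phi_bounds]]]] := realizable_target k_ge n_gt.
have N_gt0 : (0 < N)%N by lia.
have [P [polyP vP fP]] := realizable_polytope R N_gt0 H.
exists N, P, v, (N + x)%N; split; first split=> //.
- by rewrite ler_pdivrMr// mulrC -natrM ler_nat; case/andP: N_bounds.
- by case/andP: N_bounds => _; rewrite leq_pmul2l.
- split=> //.
  + exact: (vertices_comparable R k_ge v_bounds).
  + exact: (facets_comparable R k_ge n_gt phi_bounds).
  + exact: (logs_comparable R k_ge n_gt N_bounds v_bounds phi_bounds).
Unshelve. all: by end_near.
Qed.
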